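(* Let $K$ be a non-polar compact subset of $\mathbb{R}$ and let $\mu_K$ be its equilibrium measure. Then $W_n(\mu_K)\ge 1$ for all $n\in\mathbb{N}$.
   Context: $\mathbb{N}=\{1,2,\dots\}$. $\mathrm{Cap}(\cdot)$ denotes logarithmic capacity; a compact set $K$ is non-polar if $\mathrm{Cap}(K)>0$. For a non-polar compact set $K\subset\mathbb{R}$, $\mu_K$ denotes its equilibrium measure: the unique Borel probability measure on $K$ minimizing the logarithmic energy $\iint \log\frac{1}{|x-y|}\,d\mu(x)\,d\mu(y)$. For a unit Borel measure $\mu$ with infinite compact support on $\mathbb{R}$, $P_n(\cdot;\mu)$ is the $n$-th monic orthogonal polynomial for $\mu$, i.e. the monic real polynomial of degree $n$ with minimal $L^2(\mu)$ norm among all monic real polynomials of degree $n$. One defines $$W_n(\mu):=\frac{\|P_n(\cdot;\mu)\|_{L^2(\mu)}}{\mathrm{Cap}(\mathrm{supp}(\mu))^n}.$$ It holds that $\mathrm{Cap}(\mathrm{supp}(\mu_K))=\mathrm{Cap}(K)$. *)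

(* Defs.v *)
From HB Require Import structures.
From mathcomp Require Import all_boot all_order all_algebra.
From mathcomp Require Import all_classical all_reals all_analysis.
Set Implicit Arguments.
Unset Strict Implicit.
Unset Printing Implicit Defensive.
Import Order.TTheory GRing.Theory Num.Theory.
Import numFieldNormedType.Exports.
Local Open Scope classical_set_scope.
Local Open Scope ring_scope.

(* Borel probability measures on the real line *)
Notation borel_prob R := (probability (measurableTypeR R) R).

(* [lne 0 = -oo], so the kernel log (1 / |x - y|) is +oo on the diagonal. It is
   bounded below on bounded sets, so for compactly supported [mu] the integrals
   are well defined in ]-oo, +oo]. *)
Definition log_energy (R : realType) (mu : borel_prob R) : \bar R :=
  (\int[mu]_x \int[mu]_y (- lne `|x - y|%:E))%E.

(* Meant for compact K: the infimum is then > -oo, and it is +oo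
   (capacity 0) exactly when K carries no measure of finite energy, in
   particular when K is empty. *)
Definition capacity (R : realType) (K : set R) : R :=
  fine (expeR (- ereal_inf
    [set log_energy mu | mu in [set mu : borel_prob R | mu K = 1%E]])).

Definition nonpolar (R : realType) (K : set R) : Prop := 0 < capacity K.

Definition is_equilibrium_measure (R : realType) (K : set R)
    (mu : borel_prob R) : Prop :=
  mu K = 1%E /\
  forall nu : borel_prob R, nu K = 1%E -> (log_energy mu <= log_energy nu)%E.

Definition measure_support (R : realType) (mu : borel_prob R) : set R :=
  [set x | forall e : R, 0 < e -> (0 < mu (ball x e))%E].

Definition L2norm (R : realType) (mu : borel_prob R) (p : {poly R}) : \bar R :=
  ('N[mu]_2%:E [EFin \o horner p])%E.

(* [size p = n.+1] means that p has degree n. *)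
Definition is_orthopoly (R : realType) (mu : borel_prob R) (n : nat)
    (p : {poly R}) : Prop :=
  [/\ p \is monic, size p = n.+1
    & forall q : {poly R}, q \is monic -> size q = n.+1 ->
        (L2norm mu p <= L2norm mu q)%E].

(* If mu has infinite compact support, the minimizer exists and is unique,
   so the default value 0 is not used. *)
Definition orthopoly (R : realType) (mu : borel_prob R) (n : nat) : {poly R} :=
  xget 0 [set p | is_orthopoly mu n p].

Definition widom_factor (R : realType) (n : nat) (mu : borel_prob R) : R :=
  fine (L2norm mu (orthopoly mu n)) / capacity (measure_support mu) ^+ n.

(* Main.v *)
Require Import Defs.
From HB Require Import structures.
From mathcomp Require Import all_boot all_order all_algebra.
From mathcomp Require Import all_classical all_reals all_analysis.
From mathcomp Require Import complex measurable_realfun ring lra.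
Set Implicit Arguments.
Unset Strict Implicit.
Unset Printing Implicit Defensive.
Import Order.TTheory GRing.Theory Num.Theory.
Import numFieldNormedType.Exports.
Local Open Scope classical_set_scope.
Local Open Scope ring_scope.

(* Let V be the energy of mu_K, so that Cap(K) = exp(-V). By Frostman's theorem
   the logarithmic potential of mu_K is at most V everywhere. A monic polynomial
   p of degree n satisfies |p(x)| >= prod |x - a_j| at real x, where the a_j are
   the real parts of its roots, hence the mean of log |p| under mu_K is at least
   -n V, and Jensen's inequality gives ||p||^2 >= exp(-2 n V).

   Frostman's bound is obtained by perturbing mu_K towards its restriction to a
   set A. Minimality gives that the potential averages at least V over A;
   taking A to be where it does not exceed V + e shows that it exceeds V + e
   only on a null set. Lower semicontinuity then gives the bound V on the
   support, and convexity of -log on the gaps of the support gives it on the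
   whole line.

   All integrals are taken with the kernel c - log |x - y| truncated at 0, where
   c is such that no truncation occurs on K x K: this keeps every integrand
   nonnegative, so that Tonelli's theorem and monotone convergence apply. *)

(* Replacing the complex roots by their real parts can only bring them closer
   to a real point. *)
Lemma monic_ge_prod_dist_real (R : rcfType) (p : {poly R}) (n : nat) :
  p \is monic -> size p = n.+1 ->
  exists2 s : seq R, size s = n &
    forall x, \prod_(a <- s) `|x - a| <= `|p.[x]|.
Proof.
move=> pm sp.
pose f := real_complex R.
have [r hr] := closed_field_poly_normal (map_poly f p).
have lm : lead_coef (map_poly f p) = 1.
  by rewrite lead_coef_map (monicP pm) rmorph1.
rewrite lm scale1r in hr.
exists (map (@complex.Re R) r).
  have := size_map_poly f p; rewrite hr size_prod_XsubC sp size_map.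
  by case.
move=> x.
have fE y : f `|y| = `|f y|.
  by rewrite normc_def /= expr0n addr0 sqrtr_sqr.
rewrite -lecR.
have -> : `|p.[x]|%:C%C = \prod_(z <- r) `|('X - z%:P).[f x]|.
  have fp : (map_poly f p).[f x] = f p.[x] by exact: (horner_map (real_complex R)).
  by rewrite -[LHS]/(f _) fE -fp hr horner_prod normr_prod.
have -> : (\prod_(a <- [seq complex.Re i | i <- r]) `|x - a|)%:C%C =
    \prod_(a <- [seq complex.Re i | i <- r]) f `|x - a|.
  exact: (rmorph_prod f).
rewrite big_map; apply: ler_prod => z _; apply/andP; split.
  by rewrite [X in _ <= X]fE normr_ge0.
have := normc_ge_Re (f x - z); rewrite raddfB/= !hornerE.
exact.
Qed.

(** * Minimal monic polynomials for a positive semidefinite functional *)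

Section positive_functional.
Variables (R : realFieldType) (L : {poly R} -> R).
Hypothesis LD : forall p q, L (p + q) = L p + L q.
Hypothesis LZ : forall a p, L (a *: p) = a * L p.
Hypothesis L_ge0 : forall p, 0 <= L (p * p).

(** Degenerate case of Cauchy-Schwarz: [L] of the square of [q + t *: e] is affine in [t] and
    nonnegative, so its slope vanishes. *)
Lemma pos_functional_null (e q : {poly R}) : L (e * e) = 0 -> L (q * e) = 0.
Proof.
move=> e0; apply/eqP; case: eqVneq => // b0.
(* At this [t] the affine function takes the value -1. *)
pose t := - (L (q * q) + 1) / (2 * L (q * e)).
have := L_ge0 (q + t *: e).
have -> : (q + t *: e) * (q + t *: e) =
  q * q + (2 * t) *: (q * e) + (t ^+ 2) *: (e * e).
  by rewrite -!mul_polyC !polyCM ?polyC_exp ?rmorph_nat; ring.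
rewrite !LD !LZ e0 mulr0 addr0.
have -> : 2 * t * L (q * e) = - (L (q * q) + 1) by rewrite /t; field.
lra.
Qed.

(** Orthogonal projection by Gram-Schmidt. As [L] may be degenerate, the induction adds the
    direction [e], the part of ['X^n] orthogonal to lower degrees. *)
Lemma pos_functional_proj (n : nat) (f : {poly R}) :
  exists2 r : {poly R}, (size r <= n)%N &
    forall q : {poly R}, (size q <= n)%N -> L (q * (f - r)) = 0.
Proof.
have L0 : L 0 = 0 by rewrite -(scale0r 0) LZ mul0r.
elim: n f => [|n ih] f.
  by exists 0; rewrite ?size_poly0// => q; rewrite leqn0 size_poly_eq0 => /eqP ->; rewrite mul0r.
have [r0 sr0 hr0] := ih 'X^n; have [r1 sr1 hr1] := ih f.
set e := 'X^n - r0.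
pose c := L (e * (f - r1)) / L (e * e).
have ce : L (e * (f - r1)) = c * L (e * e).
  (* If [e] is null, division by zero makes [c] equal to 0, and the left side vanishes as well. *)
  rewrite /c; have [e0|e0] := eqVneq (L (e * e)) 0; last by rewrite divfK.
  by rewrite e0 mulr0 mulrC pos_functional_null.
move: c ce => c ce.
exists (r1 + c *: e).
  apply: leq_trans (size_polyD _ _) _; rewrite geq_max (leqW sr1)/=.
  apply: leq_trans (size_scale_leq _ _) _.
  apply: leq_trans (size_polyD _ _) _.
  by rewrite size_polyN size_polyXn geq_max leqnn (leqW sr0).
move=> q sq.
pose q' := q - q`_n *: e.
have en : e`_n = 1.
  by rewrite /e coefB coefXn eqxx (nth_default 0 sr0) subr0.
have sq' : (size q' <= n)%N.
  apply/leq_sizeP => j; rewrite leq_eqVlt => /predU1P[<-|nj].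
    by rewrite coefB coefZ en mulr1 subrr.
  rewrite coefB coefZ (elimT (leq_sizeP _ _) sq j nj).
  rewrite /e coefB coefXn gtn_eqF// (elimT (leq_sizeP _ _) sr0 j (ltnW nj)).
  by rewrite subr0 mulr0 subr0.
have -> : q * (f - (r1 + c *: e)) = q' * (f - r1) + (- c) *: (q' * e)
   + q`_n *: (e * (f - r1)) + (- q`_n * c) *: (e * e).
  rewrite /q' -!mul_polyC !polyCM !polyCN; ring.
by rewrite !LD !LZ hr1// hr0// ce; ring.
Qed.

(** Pythagoras: ['X^n] minus its projection is orthogonal to its difference with any other monic
    competitor, which has lower degree. *)
Lemma pos_functional_monic_min (n : nat) :
  exists p : {poly R}, [/\ p \is monic, size p = n.+1 &
    forall q : {poly R}, q \is monic -> size q = n.+1 ->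
      L (p * p) <= L (q * q)].
Proof.
have [r sr hr] := pos_functional_proj n ('X^n).
have sX : (size (- r) < size ('X^n : {poly R}))%N by rewrite size_polyN size_polyXn ltnS.
exists ('X^n - r); split.
- by rewrite monicE lead_coefDl// lead_coefXn.
- by rewrite size_polyDl// size_polyXn.
move=> q qm sq; set p := 'X^n - r.
have sd : (size (q - p)%R <= n)%N.
  apply/leq_sizeP => j; rewrite leq_eqVlt => /predU1P[<-|nj].
    rewrite coefB /p coefB coefXn eqxx (nth_default 0 sr) subr0.
    by move/monicP : qm; rewrite lead_coefE sq => ->; rewrite subrr.
  rewrite coefB nth_default ?sq// /p coefB coefXn gtn_eqF//.
  by rewrite (elimT (leq_sizeP _ _) sr j (ltnW nj)) subr0 subr0.
have -> : q * q = p * p + 2 *: ((q - p) * p) + (q - p) * (q - p).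
  by rewrite -!mul_polyC ?rmorph_nat; ring.
by rewrite !LD !LZ (hr (q - p))// mulr0 addr0 lerDl.
Qed.

End positive_functional.

(** When the integral of [f] is infinite, the negative part of [f - c] still integrates to at most
    [c], so both sides are [+oo]. *)
Lemma ge0_integral_subr d (T : measurableType d) (R : realType)
    (P : probability T R) (f : T -> \bar R) (c : R) :
  (forall x, 0 <= f x)%E -> measurable_fun [set: T] f -> 0 <= c ->
  (\int[P]_x (f x - c%:E) = \int[P]_x f x - c%:E)%E.
Proof.
move=> f0 mf c0.
have intc : (\int[P]_x (cst c%:E) x = c%:E)%E.
  by rewrite integral_cst//= probability_setT mule1.
have [foo|foo] := ltP (\int[P]_x f x)%E +oo%E.
  rewrite (@integralB _ _ _ P setT measurableT f (cst c%:E)) ?intc//.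
  - apply/integrableP; split => //.
    by under eq_integral do rewrite gee0_abs//.
  - exact: finite_measure_integrable_cst.
have {}foo : (\int[P]_x f x = +oo)%E by apply/eqP; rewrite -leye_eq.
have mfc : measurable_fun [set: T] (fun x => f x - c%:E)%E by exact: emeasurable_funB.
rewrite foo integralE.
have neg : (\int[P]_x ((fun x => f x - c%:E)^\- x) <= c%:E)%E.
  rewrite -[leRHS]intc; apply: ge0_le_integral => //.
  - exact: measurable_funeneg.
  - move=> x _; rewrite funenegE ge_max lee_fin c0 andbT.
    by rewrite fin_num_oppeB// geeDr// oppe_le0.
have pos : (\int[P]_x ((fun x => f x - c%:E)^\+ x) = +oo)%E.
  have : (\int[P]_x f x <= \int[P]_x ((fun x => f x - c%:E)^\+ x + cst c%:E x))%E.
    apply: ge0_le_integral => //.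
    - by apply: emeasurable_funD => //; exact: measurable_funepos.
    - move=> x _; by rewrite /= -leeBlDr// funeposE le_max lexx.
  rewrite ge0_integralD//; last exact: measurable_funepos.
  rewrite intc foo leye_eq => /eqP h.
  by apply/eqP; move: h; case: (\int[P]_x _)%E.
rewrite pos.
have : (0 <= \int[P]_x ((fun x => f x - c%:E)^\- x))%E by exact: integral_ge0.
by move: neg; case: (\int[P]_x ((fun x => f x - c%:E)^\- x))%E.
Qed.

(** * Energy and its first variation for a nonnegative symmetric kernel *)

Section energy.
Context d (T : measurableType d) (R : realType).
Variable g : T * T -> \bar R.
Hypothesis g0 : forall z, (0 <= g z)%E.
Hypothesis mg : measurable_fun [set: T * T] g.
Hypothesis gC : forall x y, g (x, y) = g (y, x).

Definition potential (mu : set T -> \bar R) (x : T) : \bar R :=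
  (\int[mu]_y g (x, y))%E.

Definition energy (mu : set T -> \bar R) : \bar R := (\int[mu]_x potential mu x)%E.

Definition tilt (P : probability T R) (A : set T) (mA : measurable A)
    (s : {nonneg R}) : {measure set T -> \bar R} :=
  measure_add P (mscale s (mrestr P mA)).

(** The second argument of [mnormalize] is a fallback for total mass 0 or infinite; here the mass is
    [1 + s P(A)]. *)
Definition reweight (P : probability T R) (A : set T) (mA : measurable A)
    (s : {nonneg R}) : probability T R :=
  mnormalize (tilt P mA s) P.

Variable P : probability T R.

Lemma tiltE A (mA : measurable A) s B :
  tilt P mA s B = (P B + s%:num%:E * P (B `&` A))%E.
Proof. exact: measure_addE. Qed.

Lemma reweightE A (mA : measurable A) s B :
  reweight P mA s B =
  (((1 + s%:num * fine (P A))^-1)%:E * (P B + s%:num%:E * P (B `&` A)))%E.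
Proof.
rewrite /reweight /= /mnormalize !tiltE setTI probability_setT.
have PA : P A = (fine (P A))%:E by rewrite fineK// fin_num_measure.
have k0 : 0 < 1 + s%:num * fine (P A).
  by rewrite ltr_wpDr// mulr_ge0// fine_ge0.
rewrite PA -EFinM -EFinD eqe gt_eqF//=.
by rewrite tiltE muleC.
Qed.

Lemma integral_reweight A (mA : measurable A) s f :
  (forall x, 0 <= f x)%E -> measurable_fun [set: T] f ->
  (\int[reweight P mA s]_x f x =
   ((1 + s%:num * fine (P A))^-1)%:E *
     (\int[P]_x f x + s%:num%:E * \int[mrestr P mA]_x f x))%E.
Proof.
move=> f0 mf.
have k0 : 0 <= (1 + s%:num * fine (P A))^-1.
  by rewrite invr_ge0 addr_ge0// mulr_ge0// fine_ge0.
rewrite (eq_measure_integral (mscale (NngNum k0) (tilt P mA s))); last first.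
  by move=> B mB _; rewrite [LHS]reweightE -[X in (_ * X)%E](tiltE mA).
by rewrite ge0_integral_mscale// ge0_integral_measure_add// ge0_integral_mscale.
Qed.

Lemma measurable_potential (mu : {sigma_finite_measure set T -> \bar R}) :
  measurable_fun [set: T] (potential mu).
Proof. exact: measurable_fun_fubini_tonelli_F. Qed.

Lemma potential_ge0 (mu : {measure set T -> \bar R}) x : (0 <= potential mu x)%E.
Proof. exact: integral_ge0. Qed.

Lemma energy_ge0 (mu : {measure set T -> \bar R}) : (0 <= energy mu)%E.
Proof. by apply: integral_ge0 => x _; exact: potential_ge0. Qed.

Lemma potentialC (m1 m2 : {sigma_finite_measure set T -> \bar R}) :
  (\int[m1]_x potential m2 x = \int[m2]_x potential m1 x)%E.
Proof.
rewrite /potential (@fubini_tonelli _ _ _ _ _ m1 m2 g)//.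
by apply: eq_integral => y _; apply: eq_integral => x _; exact: gC.
Qed.

Lemma integral_mrestrC A (mA : measurable A) f :
  (forall x, 0 <= f x)%E -> measurable_fun [set: T] f ->
  (\int[P]_x f x =
   \int[mrestr P mA]_x f x + \int[mrestr P (measurableC mA)]_x f x)%E.
Proof.
move=> f0 mf; rewrite -ge0_integral_measure_add//.
apply: eq_measure_integral => B mB _.
rewrite [RHS]measure_addE /mrestr [LHS](measureDI P mB mA).
by rewrite setDE addeC.
Qed.

Lemma le_integral_mrestr A (mA : measurable A) f :
  (forall x, 0 <= f x)%E -> measurable_fun [set: T] f ->
  (\int[mrestr P mA]_x f x <= \int[P]_x f x)%E.
Proof.
by move=> f0 mf; rewrite (integral_mrestrC mA)// leeDl// integral_ge0.
Qed.

(** The energy is a quadratic form in the measure: [a] is the mutual energy of [P] and its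
    restriction, counted twice by symmetry, and [b] the energy of the restriction. Both are finite
    because the kernel is nonnegative and [V] bounds them. *)
Lemma energy_reweight A (mA : measurable A) (V : R) :
  energy P = V%:E ->
  exists a b : R,
    [/\ (\int[mrestr P mA]_x potential P x = a%:E)%E, 0 <= b &
     forall s : {nonneg R}, energy (reweight P mA s) = ((1 + s%:num * fine (P A)) ^- 2 *
       (V + s%:num * a *+ 2 + s%:num ^+ 2 * b))%:E].
Proof.
move=> EV.
have mU := measurable_potential P.
have mW := measurable_potential (mrestr P mA).
have U0 := potential_ge0 P.
have W0 := potential_ge0 (mrestr P mA).
have WU x : (potential (mrestr P mA) x <= potential P x)%E.
  by apply: le_integral_mrestr => //; exact: measurableT_comp.
pose ae := (\int[mrestr P mA]_x potential P x)%E.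
pose be := (\int[mrestr P mA]_x potential (mrestr P mA) x)%E.
have ae0 : (0 <= ae)%E by apply: integral_ge0.
have be0 : (0 <= be)%E by apply: integral_ge0.
have aV : (ae <= V%:E)%E by rewrite -EV; exact: le_integral_mrestr.
have ba : (be <= ae)%E by apply: ge0_le_integral.
have afin : ae \is a fin_num.
  by rewrite ge0_fin_numE// (le_lt_trans aV)// ltry.
have bfin : be \is a fin_num.
  by rewrite ge0_fin_numE// (le_lt_trans ba)// ltey_eq afin.
exists (fine ae), (fine be); split; [by rewrite fineK|exact: fine_ge0|move=> s].
set k := (1 + s%:num * fine (P A))^-1.
have k0 : 0 <= k.
  by rewrite invr_ge0 addr_ge0// mulr_ge0// fine_ge0.
have potE x : (potential (reweight P mA s) x =
    k%:E * (potential P x + s%:num%:E * potential (mrestr P mA) x))%E.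
  by rewrite /potential integral_reweight//; exact: measurableT_comp.
have f0 x : (0 <= potential P x + s%:num%:E * potential (mrestr P mA) x)%E.
  by rewrite adde_ge0// mule_ge0.
have mf : measurable_fun [set: T]
    (fun x => potential P x + s%:num%:E * potential (mrestr P mA) x)%E.
  by apply: emeasurable_funD => //; exact: measurable_funeM.
have intE (m : {measure set T -> \bar R}) :
    (\int[m]_x (k%:E * (potential P x + s%:num%:E * potential (mrestr P mA) x)) =
     k%:E * (\int[m]_x potential P x +
       s%:num%:E * \int[m]_x potential (mrestr P mA) x))%E.
  rewrite ge0_integralZl// ge0_integralD//; last 2 first.
  - by move=> x _; rewrite mule_ge0.
  - exact: measurable_funeM.
  by rewrite ge0_integralZl.
rewrite /energy; under eq_integral do rewrite potE.
rewrite integral_reweight//; last 2 first.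
- by move=> x; rewrite mule_ge0.
- exact: measurable_funeM.
rewrite -/k !intE (potentialC P (mrestr P mA)) -/ae -/be.
have -> : (\int[P]_x potential P x)%E = V%:E by exact: EV.
rewrite -(fineK afin) -(fineK bfin) -!(EFinM, EFinD).
by congr (_%:E); rewrite -exprVn -/k; ring.
Qed.

(* First variation at the minimiser [P]: moving [P] towards its restriction
   to [A] cannot decrease the energy. *)
Lemma minimizer_integral_potential A (mA : measurable A) (V : R) :
  energy P = V%:E ->
  (forall s, (V%:E <= energy (reweight P mA s))%E) ->
  (V%:E * P A <= \int[mrestr P mA]_x potential P x)%E.
Proof.
move=> EV hmin; set m := fine (P A).
have PA : P A = m%:E by rewrite fineK// fin_num_measure.
have m0 : 0 <= m by exact: fine_ge0.
have V0 : 0 <= V by rewrite -lee_fin -EV energy_ge0.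
have [a [b [aE b0 E]]] := energy_reweight mA EV.
rewrite aE PA -EFinM lee_fin leNgt; apply/negP => ltaV.
have d0 : 0 < V * m - a by rewrite subr_gt0.
(* Expand [V (1 + s m)^2 <= V + 2 s a + s^2 b], drop the term [V (s m)^2] and divide by [s]. *)
have key (s : R) : 0 < s -> 2 * (V * m - a) <= s * b.
  move=> s0; have := hmin (NngNum (ltW s0)); rewrite E lee_fin -/m /=.
  have k0 : 0 < 1 + s * m by rewrite ltr_wpDr// mulr_ge0// ltW.
  rewrite mulrC ler_pdivlMr ?exprn_gt0// => h.
  rewrite -(ler_pM2l s0).
  have : 0 <= V * (s * m) ^+ 2 by rewrite mulr_ge0// sqr_ge0.
  by lra.
have b1 : 0 < b + 1 by rewrite ltr_wpDl.
(* Taking [b + 1] rather than [b] avoids a zero denominator. *)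
have := key _ (divr_gt0 d0 b1).
rewrite mulrAC ler_pdivlMr//.
have : 0 <= (V * m - a) * b by rewrite mulr_ge0// ltW.
lra.
Qed.

(** The first variation bounds the integral over the complement of [B] below by [V] times its mass;
    on [B] the potential exceeds [V + e]. Adding up, [V >= V + e P(B)]. *)
Lemma minimizer_potential_gt_null (V e : R) :
  energy P = V%:E -> 0 < e ->
  (forall A (mA : measurable A) s, (V%:E <= energy (reweight P mA s))%E) ->
  P [set x | ((V + e)%:E < potential P x)%E] = 0%E.
Proof.
move=> EV e0 hmin; set B := [set x | _].
have mU := measurable_potential P.
have mB : measurable B.
  have := emeasurable_fun_o_infty measurableT mU (V + e)%:E.
  by rewrite setTI.
have mBc := measurableC mB; have mBcc := measurableC mBc.
have h1 := minimizer_integral_potential EV (hmin _ mBc).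
(* The double complement is the form in which [integral_mrestrC] returns [B]. *)
have h2 : ((V + e)%:E * P B <= \int[mrestr P mBcc]_x potential P x)%E.
  have -> : P B = mrestr P mBcc B by rewrite /mrestr setCK setIid.
  rewrite -integral_cst//; apply: le_trans (_ : _ <=
      \int[mrestr P mBcc]_(x in B) potential P x)%E _.
    apply: ge0_le_integral => //.
    - by move=> x Bx; rewrite lee_fin addr_ge0// ?(ltW e0)// -lee_fin -EV energy_ge0.
    - exact: measurable_funTS.
    - by move=> x; apply: ltW.
  by apply: ge0_subset_integral => // x _; exact: potential_ge0.
have PBfin : P B = (fine (P B))%:E by rewrite fineK// fin_num_measure.
have := leeD h1 h2.
rewrite -integral_mrestrC//; last by move=> x; exact: potential_ge0.
have -> : (\int[P]_x potential P x)%E = V%:E by exact: EV.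
rewrite probability_setC// PBfin -EFinB -!EFinM -EFinD lee_fin => h.
have : e * fine (P B) <= 0 by lra.
rewrite pmulr_rle0// => h0.
by congr (_%:E); apply/eqP; rewrite eq_le h0 fine_ge0.
Qed.

End energy.

(** * The truncated logarithmic kernel *)

Section log_kernel.
Variable R : realType.
Implicit Types (c x y : R).

(* On [|x - y| <= e^c] this is the logarithmic kernel shifted by [c]; the
   truncation makes it nonnegative everywhere. *)
Definition lkern c (z : measurableTypeR R * measurableTypeR R) : \bar R :=
  maxe 0%E (c%:E - lne `|z.1 - z.2|%:E)%E.

Lemma lkern_ge0 c z : (0 <= lkern c z)%E.
Proof. by rewrite le_max lexx. Qed.

Lemma lkernC c x y : lkern c (x, y) = lkern c (y, x).
Proof. by rewrite /lkern /= distrC. Qed.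

Lemma lne_EFin_le (r s : R) : r <= s -> (lne r%:E <= lne s%:E)%E.
Proof.
move=> rs; rewrite /lne; case: ifPn => [_|]; first exact: leNye.
rewrite -ltNge => r0; have s0 := lt_le_trans r0 rs.
have -> : (s <= 0) = false by apply/negbTE; rewrite -ltNge.
by rewrite lee_fin ler_ln ?posrE.
Qed.

Lemma lkern_ge c x y : (c%:E - lne `|x - y|%R%:E <= lkern c (x, y))%E.
Proof. by rewrite le_max lexx orbT. Qed.

Lemma lkernE c x y : `|x - y| <= expR c ->
  lkern c (x, y) = (c%:E - lne `|x - y|%R%:E)%E.
Proof.
move=> h; apply/max_idPr. rewrite sube_ge0 ?orbT//.
by have := lne_EFin_le h; rewrite (lne_EFin (expR_gt0 c)) expRK.
Qed.

Lemma lkern_le c x y x' y' : `|x - y| <= `|x' - y'| ->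
  (lkern c (x', y') <= lkern c (x, y))%E.
Proof.
move=> h; rewrite /lkern /= ge_max !le_max lexx/=.
by rewrite leeD2l ?orbT// leeN2 lne_EFin_le.
Qed.

Lemma measurable_lne_EFin : measurable_fun [set: R] (fun r : R => lne r%:E).
Proof.
rewrite /lne /=; apply: measurable_fun_ifT => //=.
  by apply: measurable_fun_ler.
by apply/measurable_EFinP; exact: measurable_ln.
Qed.

Lemma measurable_lkern c :
  measurable_fun [set: measurableTypeR R * measurableTypeR R] (lkern c).
Proof.
apply: measurable_maxe => //; apply: emeasurable_funB => //.
apply: (measurableT_comp measurable_lne_EFin).
apply: (measurableT_comp (@normr_measurable R setT)) => /=.
by apply: measurable_funB; [exact: measurable_fst|exact: measurable_snd].
Qed.

Lemma lkern_diag c x : lkern c (x, x) = +oo%E.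
Proof. by rewrite /lkern /= subrr normr0 lexx maxey. Qed.

(** As [y] is not strictly between [a] and [b], the distance to [y] is affine on the segment, and
    -log is convex. *)
Lemma lkern_conv c (a b y t : R) : 0 < t < 1 -> a < b -> y <= a \/ b <= y ->
  (lkern c (((1 - t) * a + t * b)%R, y) <=
   (1 - t)%R%:E * lkern c (a, y) + t%:E * lkern c (b, y))%E.
Proof.
move=> /andP[t0 t1] ab yab.
have t1' : 0 < 1 - t by rewrite subr_gt0.
have RHS0 : (0 <= (1 - t)%R%:E * lkern c (a, y) + t%:E * lkern c (b, y))%E.
  by rewrite adde_ge0// mule_ge0// ?lkern_ge0// lee_fin ltW.
(* If an endpoint equals [y], the right side is [+oo]. *)
have [ay|ay] := eqVneq a y.
  by rewrite -ay lkern_diag gt0_muley ?lte_fin// addye ?leey// -ltNye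
    (lt_le_trans _ (mule_ge0 _ (lkern_ge0 _ _))) ?lee_fin ?ltW.
have [eby|eby] := eqVneq b y.
  by rewrite -eby lkern_diag gt0_muley ?lte_fin// addey ?leey// -ltNye
    (lt_le_trans _ (mule_ge0 _ (lkern_ge0 _ _))) ?lee_fin ?ltW.
rewrite {1}/lkern ge_max RHS0/=.
set u := `|a - y|; set v := `|b - y|.
have u0 : 0 < u by rewrite normr_gt0 subr_eq0.
have v0 : 0 < v by rewrite normr_gt0 subr_eq0.
have -> : `|(1 - t) * a + t * b - y| = (1 - t) * u + t * v.
  rewrite /u /v; case: yab => h.
    rewrite !ger0_norm; [by ring|lra|lra|].
    by have : 0 <= t * (b - a); [apply: mulr_ge0; lra|lra].
  rewrite !ler0_norm; [by ring|lra|lra|].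
  have : 0 <= (1 - t) * (b - a) by apply: mulr_ge0; lra.
  lra.
have uv0 : 0 < (1 - t) * u + t * v by rewrite addr_gt0// mulr_gt0.
have le1 := lkern_ge c a y; have le2 := lkern_ge c b y.
apply: (@le_trans _ _ ((1 - t)%R%:E * (c%:E - lne u%:E) +
   t%:E * (c%:E - lne v%:E))%E); last first.
  by apply: leeD; apply: lee_wpmul2l => //; rewrite lee_fin ltW.
rewrite !lne_EFin// (leNgt ((1 - t) * u + t * v)) uv0 /= -!(EFinM, EFinB, EFinD) lee_fin.
set w := (1 - t) * u + t * v.
(* The graph of [ln] lies below its tangent at [w]; the weighted tangent increments at [u] and [v]
   cancel. *)
have tangent z : 0 < z -> ln z - ln w <= z / w - 1.
  move=> z0; rewrite -ln_div ?posrE// -[X in ln X](subrK 1) addrC.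
  by apply: le_ln1Dx; rewrite ltrBrDr addNr divr_gt0.
have : (1 - t) * (u / w - 1) + t * (v / w - 1) = 0.
  by rewrite /w; field; rewrite gt_eqF.
have : (1 - t) * (ln u - ln w) <= (1 - t) * (u / w - 1).
  by rewrite ler_pM2l// tangent.
have : t * (ln v - ln w) <= t * (v / w - 1) by rewrite ler_pM2l// tangent.
lra.
Qed.

End log_kernel.

(** * The support of a Borel probability measure *)

Section support.
Variables (R : realType) (P : borel_prob R).
Let S := measure_support P.

Lemma measure_support_adherent x :
  (forall e : R, 0 < e -> exists2 y, S y & `|x - y| < e) -> S x.
Proof.
move=> h e e0; have e20 : 0 < e / 2 by rewrite divr_gt0.
have [y Sy xy] := h _ e20.
apply: (lt_le_trans (Sy _ e20)); apply: le_measure; rewrite ?inE.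
- exact: measurable_ball.
- exact: measurable_ball.
move=> z; rewrite /ball /= => yz.
rewrite -(subrKA y); apply: (le_lt_trans (ler_normD _ _)).
by rewrite [e]splitr ltrD.
Qed.

Lemma closed_measure_support : closed S.
Proof.
move=> x clx; apply: measure_support_adherent => e e0.
by have [y [Sy xy]] := clx _ (nbhsx_ballx x e e0); exists y.
Qed.

Lemma measurable_measure_support : measurable (S : set (measurableTypeR R)).
Proof. exact: closed_measurable closed_measure_support. Qed.

(** A point off the support has a null ball around it, hence a null interval with rational
    endpoints; there are countably many of these. *)
Lemma measure_supportC : P (~` S) = 0%E.
Proof.
pose I (q : rat * rat) : set (measurableTypeR R) := `]ratr q.1, ratr q.2[%classic.
pose F n := if unpickle n is Some q then
  (if P (I q) == 0%E then I q else set0) else set0.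
have F0 n : P.-negligible (F n).
  rewrite /F; case: (unpickle n) => [q|]; last exact: negligible_set0.
  case: eqP => [Pq|_]; last exact: negligible_set0.
  by apply/negligibleP => //; exact: measurable_itv.
apply/(negligibleP _ (measurableC measurable_measure_support)).
apply: negligibleS (negligible_bigcup F0) => x /= nSx.
have [e /= e0 Pe] : exists2 e : R, 0 < e & P (ball x e) = 0%E.
  apply: contrapT => h; apply: nSx => e e0.
  rewrite lt_neqAle measure_ge0 andbT; apply/eqP => Pe.
  by apply: h; exists e.
have xe1 : x - e < x by rewrite ltrBlDr ltrDl.
have xe2 : x < x + e by rewrite ltrDl.
have [q1] := rat_in_itvoo xe1; rewrite in_itv/= => /andP[q1l q1r].
have [q2] := rat_in_itvoo xe2; rewrite in_itv/= => /andP[q2l q2r].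
exists (pickle (q1, q2)); first exact: Logic.I.
rewrite /F pickleK.
suff -> : P (I (q1, q2)) = 0%E by rewrite eqxx /I /= in_itv/= q1r q2l.
apply/eqP; rewrite -measure_le0 -Pe; apply: le_measure; rewrite ?inE.
- exact: measurable_itv.
- exact: measurable_ball.
move=> z; rewrite /I /= in_itv/= ball_itv/= in_itv/= => /andP[z1 z2].
by rewrite (lt_trans q1l z1) (lt_trans z2 q2r).
Qed.

Lemma prob_measure_support : P S = 1%E.
Proof.
have := probability_setC P (measurableC measurable_measure_support).
by rewrite setCK measure_supportC sube0.
Qed.

Lemma measure_support_sub (K : set R) : closed K -> P K = 1%E -> S `<=` K.
Proof.
move=> cK PK x Sx; apply: contrapT => nKx.
have : nbhs x (~` K) by apply: open_nbhs_nbhs; split => //; exact: closed_openC.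
move=> /nbhs_ballP[e /= e0 he].
have := Sx _ e0; rewrite lt_neqAle => /andP[/eqP + _]; apply.
have mK : measurable (K : set (measurableTypeR R)) by exact: closed_measurable.
apply/esym/eqP; rewrite -measure_le0.
apply: le_trans (_ : P (~` K) <= 0)%E; last by rewrite probability_setC// PK subee.
by apply: le_measure => //; rewrite inE; [exact: measurable_ball|exact: measurableC].
Qed.

End support.

Local Arguments lne : simpl never.

(** * Lower semicontinuity of the logarithmic potential *)

Section log_potential.
Variables (R : realType) (P : borel_prob R) (c : R).
Let S := measure_support P.
Let U := potential (lkern c) P.

Lemma measurable_lkernr (x : R) :
  measurable_fun [set: measurableTypeR R] (fun y => lkern c (x, y)).
Proof. exact: measurableT_comp (measurable_lkern c) (pair1_measurable x). Qed.

Lemma log_potential_le (z : R) (f : R -> \bar R) :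
  measurable_fun [set: measurableTypeR R] f -> (forall y, 0 <= f y)%E ->
  (forall y, S y -> lkern c (z, y) <= f y)%E ->
  (U z <= \int[P]_y f y)%E.
Proof.
move=> mf f0 h; apply: ae_ge0_le_integral => //.
- by move=> y _; exact: lkern_ge0.
- exact: measurable_lkernr.
exists (~` S); split; [|exact: measure_supportC|].
  by apply: measurableC; exact: measurable_measure_support.
by move=> y /=; apply: contra_not => Sy _; exact: h.
Qed.

(** The kernel regularised by adding [1/(n+1)] to the distance reaches every level strictly below
    the true kernel, also on the diagonal. *)
Lemma lkern_lt_approx (x y s : R) : (s%:E < lkern c (x, y))%E -> 0 <= s ->
  exists n, s <= c - ln (`|x - y| + n.+1%:R^-1).
Proof.
move=> + s0; rewrite lt_max => /orP[|/= h]; first by rewrite lte_fin ltNge s0.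
have {}h : `|x - y| < expR (c - s).
  have [->|xy] := eqVneq `|x - y| 0; first exact: expR_gt0.
  have xy0 : 0 < `|x - y| by rewrite lt_neqAle eq_sym xy/=.
  move: h; rewrite lne_EFin// lte_fin => h.
  by rewrite -[X in X < _]lnK// ltr_expR; lra.
have [n hn] := ltr_add_invr h; exists n.
rewrite lerBrDr addrC -lerBrDr -[X in _ <= X]expRK ler_ln ?posrE ?expR_gt0 ?ltr_wpDl//.
exact: ltW.
Qed.

(** The regularised kernels [h n] at [x0] lie below the kernel at any [x] within [1/(n+1)] of [x0],
    so their integrals are at most [C]; monotone convergence passes to the limit. *)
Lemma log_potential_lsc (x0 C : R) :
  (forall e : R, 0 < e -> exists2 x, `|x0 - x| < e & (U x <= C%:E)%E) ->
  (U x0 <= C%:E)%E.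
Proof.
move=> hx.
pose h n y := maxe 0%E (c - ln (`|x0 - y| + n.+1%:R^-1))%:E.
have h0 n y : (0 <= h n y)%E by rewrite le_max lexx.
have mh n : measurable_fun [set: measurableTypeR R] (h n).
  apply: measurable_maxe => //; apply/measurable_EFinP.
  apply: measurable_funB => //; apply: measurableT_comp => //.
  apply: measurable_funD => //; apply: measurableT_comp => //.
  exact: measurable_funB.
have ndh y : {homo (h ^~ y) : n m / (n <= m)%N >-> (n <= m)%E}.
  move=> n m nm; rewrite /h ge_max !le_max lexx/=.
  apply/orP; right; rewrite lee_fin lerD2l lerN2 ler_ln ?posrE ?ltr_wpDl//.
  by rewrite lerD2l lef_pV2 ?posrE// ler_nat ltnS.
have hC n : (\int[P]_y h n y <= C%:E)%E.
  have [x xx0 Ux] := hx n.+1%:R^-1 ltac:(by rewrite invr_gt0).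
  apply: le_trans Ux; apply: ge0_le_integral => //.
    exact: measurable_lkernr.
  move=> y _; rewrite /h ge_max lkern_ge0/=.
  have p : 0 < `|x0 - y| + n.+1%:R^-1 by rewrite ltr_wpDl.
  apply: le_trans (lkern_ge c x y); rewrite EFinB leeD2l// leeN2 -(lne_EFin p).
  apply: lne_EFin_le; rewrite -(subrKA x0) addrC.
  by apply: (le_trans (ler_normD _ _)); rewrite lerD2l distrC ltW.
have hlim y : (lkern c (x0, y) <= limn (h ^~ y))%E.
  have cvgh := ereal_nondecreasing_cvgn (ndh y).
  have ubh n : (h n y <= limn (h ^~ y))%E.
    rewrite (cvg_lim _ cvgh)//; apply: ereal_sup_ubound; by exists n.
  rewrite leNgt; apply/negP.
  case E : (limn (h ^~ y)) => [l| |]; last 2 first.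
  - by rewrite ltNge leey.
  - by have := le_trans (h0 0%N y) (ubh 0%N); rewrite E.
  have l0 : 0 <= l by have := le_trans (h0 0%N y) (ubh 0%N); rewrite E lee_fin.
  move=> ll; have [s ls] : exists2 s : R, l < s & (s%:E < lkern c (x0, y))%E.
    move: ll; case: (lkern c (x0, y)) => [r| |//].
      by rewrite lte_fin => lr; exists ((l + r) / 2); rewrite ?lte_fin; lra.
    by move=> _; exists (l + 1); rewrite ?ltry// ltrDl.
  move=> /lkern_lt_approx-/(_ (le_trans l0 (ltW ls)))[n sn].
  have := ubh n; rewrite E /h ge_max lee_fin => /andP[_]; rewrite lee_fin => nl.
  by move: (lt_le_trans ls (le_trans sn nl)); rewrite ltxx.
apply: (@le_trans _ _ (\int[P]_y limn (h ^~ y))%E).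
  apply: ge0_le_integral => //.
  - by move=> y _; exact: lkern_ge0.
  - exact: measurable_lkernr.
  - apply: (emeasurable_fun_cvg h) => // y _.
    exact: (ereal_nondecreasing_is_cvgn (ndh y)).
rewrite monotone_convergence//.
apply: lime_le; last exact: nearW.
apply: ereal_nondecreasing_is_cvgn => n m nm.
by apply: ge0_le_integral => // y _; exact: ndh.
Qed.

End log_potential.

(** * Frostman's upper bound on the potential *)

Section frostman.
Variables (R : realType) (P : borel_prob R) (c : R).
Let S := measure_support P.
Let U := potential (lkern c) P.

(** Each ball around a support point has positive mass, so it contains a point where the potential
    is at most [V + e]. *)
Lemma log_potential_support (V : R) :
  (forall e, 0 < e -> P [set x | ((V + e)%:E < U x)%E] = 0%E) ->
  forall x, S x -> (U x <= V%:E)%E.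
Proof.
move=> hV x Sx; apply/lee_addgt0Pr => e e0; rewrite -EFinD.
apply: log_potential_lsc => r r0.
apply: contrapT => h; have := Sx r r0; apply/negP; rewrite -leNgt -(hV e e0).
apply: le_measure; rewrite ?inE.
- exact: measurable_ball.
- have mU : measurable_fun [set: measurableTypeR R] U.
    by apply: measurable_potential; [exact: lkern_ge0|exact: measurable_lkern].
  by have := emeasurable_fun_o_infty measurableT mU (V + e)%:E; rewrite setTI.
move=> y xy /=; rewrite ltNge; apply/negP => Uy.
by apply: h; exists y.
Qed.

(* The potential is convex on each bounded gap of the support and monotone on
   the unbounded ones, so on the line the maximum principle is elementary. *)
Lemma log_potential_le_support (V : R) :
  (forall x, S x -> (U x <= V%:E)%E) -> forall z, (U z <= V%:E)%E.
Proof.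
move=> hV z; have [/hV//|nSz] := pselect (S z).
(* The support is split at [z]; [sup A] and [inf B] are the support points nearest to [z] on either
   side. *)
pose A := S `&` [set y | y <= z]; pose B := S `&` [set y | z <= y].
have Sneq y : S y -> y != z by move=> Sy; apply/eqP => yz; rewrite -yz in nSz.
have supA : A !=set0 -> S (sup A) /\ sup A < z /\ (forall y, A y -> y <= sup A).
  move=> A0; have hsA : has_sup A by split => //; exists z => y [].
  have SA : S (sup A).
    apply: measure_support_adherent => e e0.
    have [y Ay yl] := sup_adherent e0 hsA.
    exists y; first by case: Ay.
    by rewrite ger0_norm ?subr_ge0 ?ub_le_sup//; [lra|case: hsA].
  split => //; split; last by move=> y Ay; apply: ub_le_sup => //; case: hsA.
  by rewrite lt_neqAle Sneq//= ge_sup// => y [].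
have infB : B !=set0 -> S (inf B) /\ z < inf B /\ (forall y, B y -> inf B <= y).
  move=> B0; have hiB : has_inf B by split => //; exists z => y [].
  have SB : S (inf B).
    apply: measure_support_adherent => e e0.
    have [y By yl] := inf_adherent e0 hiB.
    exists y; first by case: By.
    by rewrite distrC ger0_norm ?subr_ge0 ?ge_inf//; [lra|case: hiB].
  split => //; split; last by move=> y By; apply: ge_inf => //; case: hiB.
  by rewrite lt_neqAle eq_sym Sneq//= lb_le_inf// => y [].
have AB y : S y -> A y \/ B y.
  by move=> Sy; have [yz|/ltW zy] := leP y z; [left|right].
(* If the support lies on one side of [z], moving [z] to its nearest point brings it closer to the
   whole support and so can only raise the potential. *)
have mono (x : R) : S x -> (forall y, S y -> `|x - y| <= `|z - y|) ->
    (U z <= V%:E)%E.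
  move=> Sx h; apply: le_trans (hV _ Sx).
  apply: log_potential_le; [exact: measurable_lkernr|by move=> y; exact: lkern_ge0|].
  by move=> y Sy; apply: lkern_le; exact: h.
have [A0|/set0P A0] := eqVneq A set0; have [B0|/set0P B0] := eqVneq B set0.
- exfalso; have S0 : S = set0.
    by rewrite -subset0 => y /AB; rewrite A0 B0 => -[].
  have := prob_measure_support P; rewrite -/S S0 measure0 => /eqP.
  by rewrite eq_sym onee_eq0.
- have [Sb [zb hb]] := infB B0; apply: (mono _ Sb) => y /AB; rewrite A0 => -[//|By].
  have := hb _ By => iy; rewrite !ler0_norm; lra.
- have [Sa [za ha]] := supA A0; apply: (mono _ Sa) => y /AB; rewrite B0 => -[Ay|//].
  have := ha _ Ay => iy; rewrite !ger0_norm; lra.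
have [Sb [zb hb]] := infB B0; have [Sa [za ha]] := supA A0.
set a := sup A in Sa za ha; set b := inf B in Sb zb hb.
have ab : 0 < b - a by lra.
pose t := (z - a) / (b - a).
have t0 : 0 < t by rewrite /t divr_gt0// subr_gt0.
have t1 : t < 1 by rewrite /t ltr_pdivrMr// mul1r; lra.
have t1' : 0 <= 1 - t by rewrite subr_ge0 ltW.
have zE : z = (1 - t) * a + t * b by rewrite /t; field; rewrite gt_eqF.
have mk x : measurable_fun [set: measurableTypeR R] (fun y => lkern c (x, y)).
  exact: measurable_lkernr.
apply: (@le_trans _ _ (\int[P]_y ((1 - t)%:E * lkern c (a, y) + t%:E * lkern c (b, y)))%E).
  apply: log_potential_le.
  - by apply: emeasurable_funD; apply: measurable_funeM.
  - by move=> y; rewrite adde_ge0// mule_ge0// ?lkern_ge0// lee_fin// ltW.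
  - move=> y Sy; rewrite {1}zE; apply: lkern_conv; rewrite ?t0 -?(subr_gt0 a)//.
    by case: (AB y Sy) => [/ha|/hb]; [left|right].
rewrite ge0_integralD//; last 4 first.
- by move=> y _; rewrite mule_ge0// lkern_ge0.
- exact: measurable_funeM.
- by move=> y _; rewrite mule_ge0// ?lkern_ge0// lee_fin ltW.
- exact: measurable_funeM.
rewrite !ge0_integralZl//; [|by move=> y _; exact: lkern_ge0|by rewrite lee_fin ltW|
  by move=> y _; exact: lkern_ge0].
apply: (@le_trans _ _ ((1 - t)%:E * V%:E + t%:E * V%:E)%E).
  by apply: leeD; apply: lee_wpmul2l; rewrite ?lee_fin ?(ltW t0)//; exact: hV.
by rewrite -!EFinM -EFinD lee_fin; lra.
Qed.

End frostman.

(** * From the truncated kernel back to the logarithmic energy *)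

Section log_energy_shift.
Variables (R : realType) (K : set R) (c : R).
Hypothesis c0 : 0 <= c.
Hypothesis mK : measurable (K : set (measurableTypeR R)).
Hypothesis Kc : forall x y, K x -> K y -> `|x - y| <= expR c.

(** [nu] does not charge the complement of [K], so both the inner and the outer integrand may be
    replaced by their values on [K], where no truncation occurs. *)
Lemma log_energy_shift (nu : borel_prob R) : nu K = 1%E ->
  log_energy nu = (energy (lkern c) nu - c%:E)%E.
Proof.
move=> nuK.
have aeK (f g : measurableTypeR R -> \bar R) : measurable_fun setT f -> measurable_fun setT g ->
    (forall x, K x -> f x = g x) -> (\int[nu]_x f x = \int[nu]_x g x)%E.
  move=> mf mg fg; apply: ae_eq_integral => //.
  exists (~` K); split; first exact: measurableC.
    by have := probability_setC nu mK; rewrite nuK subee.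
  by move=> x /=; apply: contra_not => Kx _; exact: fg.
have mk : measurable_fun [set: measurableTypeR R * measurableTypeR R]
    (fun z : measurableTypeR R * measurableTypeR R => - lne `|z.1 - z.2|%R%:E)%E.
  apply: measurableT_comp => //; apply: (measurableT_comp (@measurable_lne_EFin R)).
  apply: (measurableT_comp (@normr_measurable R setT)) => /=.
  by apply: measurable_funB; [exact: measurable_fst|exact: measurable_snd].
have mpot : measurable_fun [set: measurableTypeR R] (potential (lkern c) nu).
  by apply: measurable_potential; [exact: lkern_ge0|exact: measurable_lkern].
have pot0 x : (0 <= potential (lkern c) nu x)%E.
  by apply: potential_ge0; exact: lkern_ge0.
rewrite /energy -ge0_integral_subr// /log_energy; apply: (aeK).
- pose k (z : measurableTypeR R * measurableTypeR R) :=
    (- lne `|z.1 - z.2|%R%:E)%E.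
  (* The kernel is signed, so measurability of its inner integral comes from Tonelli applied to each
     part. *)
  rewrite (_ : (fun x => _) = (fun x => \int[nu]_y (k^\+)%E (x, y) -
      \int[nu]_y (k^\-)%E (x, y))%E); last first.
    apply/funext => x; rewrite integralE; congr (_ - _)%E;
      by apply: eq_integral => y _; rewrite ?funeposE ?funenegE.
  apply: emeasurable_funB.
    by apply: measurable_fun_fubini_tonelli_F => //; exact: measurable_funepos.
  by apply: measurable_fun_fubini_tonelli_F => //; exact: measurable_funeneg.
- exact: emeasurable_funB.
move=> x Kx; rewrite -ge0_integral_subr//; last 2 first.
- by move=> y; exact: lkern_ge0.
- exact: measurable_lkernr.
apply: (aeK).
- exact: measurableT_comp mk (pair1_measurable x).
- by apply: emeasurable_funB => //; exact: measurable_lkernr.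
move=> y Ky; rewrite lkernE; last exact: Kc.
by rewrite addeAC subee// add0e.
Qed.

End log_energy_shift.

(** * Polynomial moments and existence of the orthogonal polynomials *)

Section polynomial_moments.
Variables (R : realType) (K : set R) (P : borel_prob R).
Hypothesis cK : compact K.
Hypothesis PK : P K = 1%E.

Lemma integrable_horner (p : {poly R}) : P.-integrable setT (EFin \o horner p).
Proof.
have [M [Mr hM]] : bounded_set (horner p @` K).
  apply: compact_bounded; apply: continuous_compact cK.
  by apply: continuous_subspaceT; exact: continuous_horner.
have {}hM x : K x -> `|p.[x]| <= M + 1 by move=> Kx; apply: (hM (M + 1)); [lra|exists x].
have mp : measurable_fun [set: measurableTypeR R] (horner p) by exact: measurable_poly.
apply/integrableP; split; first exact/measurable_EFinP.
have [x0 Kx0] : K !=set0.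
  apply/set0P; apply/eqP => K0; move: PK; rewrite K0 measure0 => /eqP.
  by rewrite eq_sym onee_eq0.
have M0 : 0 <= M + 1 by apply: le_trans (hM _ Kx0).
apply: (@le_lt_trans _ _ (\int[P]_x (cst (M + 1)%:E) x)%E).
  apply: ae_ge0_le_integral => //.
  - by apply: measurableT_comp => //; exact/measurable_EFinP.
  exists (~` K); split; first by apply: measurableC; exact: compact_measurable.
    by have := probability_setC P (compact_measurable cK); rewrite PK subee.
  by move=> x /=; apply: contra_not => Kx _; rewrite lee_fin; exact: hM.
by rewrite integral_cst//= probability_setT mule1 ltry.
Qed.

Definition poly_mean (p : {poly R}) : R := Rintegral P setT (horner p).

Lemma poly_meanE (p : {poly R}) : (\int[P]_x (p.[x])%:E = (poly_mean p)%:E)%E.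
Proof.
rewrite /poly_mean /Rintegral fineK//.
exact: integrable_fin_num (integrable_horner p).
Qed.

Lemma poly_meanD p q : poly_mean (p + q) = poly_mean p + poly_mean q.
Proof.
rewrite /poly_mean -RintegralD//; try exact: integrable_horner.
by apply: eq_Rintegral => x _; exact: hornerD.
Qed.

Lemma poly_meanZ a p : poly_mean (a *: p) = a * poly_mean p.
Proof.
rewrite /poly_mean -RintegralZl//; try exact: integrable_horner.
by apply: eq_Rintegral => x _; exact: hornerZ.
Qed.

Lemma poly_mean_sqr_ge0 p : 0 <= poly_mean (p * p).
Proof. apply: Rintegral_ge0 => x _; rewrite -[leRHS]/((p * p).[x]).
by rewrite hornerM -expr2 sqr_ge0. Qed.

Lemma L2normE p : L2norm P p = (Num.sqrt (poly_mean (p * p)))%:E.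
Proof.
rewrite /L2norm unlock.
under eq_integral => x _.
  rewrite /= powR_mulrn// real_normK ?num_real// expr2 -hornerM.
  over.
by rewrite /= poly_meanE poweR_EFin powR12_sqrt// poly_mean_sqr_ge0.
Qed.

(** The mean under [P] is a positive functional, so a minimiser exists and [xget] does not return
    its default. *)
Lemma orthopolyP n : is_orthopoly P n (orthopoly P n).
Proof.
have [p [pm sp hp]] :=
  pos_functional_monic_min poly_meanD poly_meanZ poly_mean_sqr_ge0 n.
apply: (@xgetPex _ 0 [set p | is_orthopoly P n p]); exists p; split => // q qm sq.
by rewrite !L2normE lee_fin ler_wsqrtr// hp.
Qed.

End polynomial_moments.

(** * Capacity in terms of the equilibrium energy *)

Section capacity.
Variables (R : realType) (K : set R) (mu : borel_prob R).
Hypothesis eqmu : is_equilibrium_measure K mu.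

Lemma capacity_equilibrium : capacity K = fine (expeR (- log_energy mu)%E).
Proof.
have [muK hmin] := eqmu; rewrite /capacity; congr (fine (expeR (- _)%E)).
apply/eqP; rewrite eq_le; apply/andP; split.
  by apply: ereal_inf_lbound; exists mu.
by apply: le_ereal_inf_tmp => _ [nu nuK <-]; exact: hmin.
Qed.

(** Measures on the support are competitors on [K]. This makes the capacity in the Widom factor,
    that of the support, computable from the energy of [mu]. *)
Lemma equilibrium_measure_support :
  closed K -> is_equilibrium_measure (measure_support mu) mu.
Proof.
have [muK hmin] := eqmu; move=> cK; split; first exact: prob_measure_support.
move=> nu nuS; apply: hmin; apply/eqP; rewrite eq_le probability_le1/=; last first.
  exact: closed_measurable.
rewrite -nuS; apply: le_measure; rewrite ?inE.
- exact: measurable_measure_support.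
- exact: closed_measurable.
- exact: measure_support_sub.
Qed.

(** Either infinite energy would give capacity 0, since [fine] sends infinities to 0. *)
Lemma nonpolar_log_energy : nonpolar K -> exists V, log_energy mu = V%:E.
Proof.
rewrite /nonpolar capacity_equilibrium; case: (log_energy mu) => [V| |].
- by exists V.
- by rewrite /= ltxx.
- by rewrite /= ltxx.
Qed.

End capacity.

Lemma compact_dist_le_expR (R : realType) (K : set R) : compact K ->
  exists2 c : R, 0 <= c & forall x y, K x -> K y -> `|x - y| <= expR c.
Proof.
move=> /compact_bounded[M [Mr hM]].
(* The set lies within distance [|M| + 1] of 0, so distances are at most [c], and
   [c <= 1 + c <= expR c]. *)
exists (2 * (`|M| + 1)); first by rewrite mulr_ge0// addr_ge0.
have hK x : K x -> `|x| <= `|M| + 1.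
  by move=> Kx; apply: (hM (`|M| + 1)) => //; rewrite (le_lt_trans (ler_norm M))// ltrDl.
move=> x y Kx Ky; apply: (le_trans (ler_normB _ _)).
apply: (@le_trans _ _ (1 + 2 * (`|M| + 1))); last exact: expR_ge1Dx.
by have := hK _ Kx; have := hK _ Ky; lra.
Qed.

(** * Frostman's bound for the equilibrium measure *)

Section equilibrium.
Variables (R : realType) (K : set R) (mu : borel_prob R) (c V : R).
Hypothesis mK : measurable (K : set (measurableTypeR R)).
Hypothesis c0 : 0 <= c.
Hypothesis Kc : forall x y, K x -> K y -> `|x - y| <= expR c.
Hypothesis eqmu : is_equilibrium_measure K mu.
Hypothesis EV : log_energy mu = V%:E.

Lemma equilibrium_potential_le z : (potential (lkern c) mu z <= (V + c)%:E)%E.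
Proof.
have [muK hmin] := eqmu.
have g0 := @lkern_ge0 R c; have mg := @measurable_lkern R c; have gC := @lkernC R c.
have E : energy (lkern c) mu = (V + c)%:E.
  have := log_energy_shift c0 mK Kc muK; rewrite EV => h.
  by rewrite EFinD h subeK.
apply: log_potential_le_support => x; apply: log_potential_support => e e0.
apply: minimizer_potential_gt_null => // A mA s.
(* A reweighted measure has the null sets of [mu], so it remains a competitor on [K]. *)
have rK : reweight mu mA s K = 1%E.
  have : reweight mu mA s (~` K) = 0%E.
    rewrite [LHS]reweightE.
    have muKC : mu (~` K) = 0%E.
      by have := probability_setC mu mK; rewrite muK subee.
    rewrite muKC (_ : mu (~` K `&` A) = 0%E) ?mule0 ?adde0 ?mule0//.
    apply/eqP; rewrite -measure_le0 -muKC; apply: le_measure; rewrite ?inE.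
    - by apply: measurableI => //; exact: measurableC.
    - exact: measurableC.
    - exact: subIsetl.
  move=> h; have := probability_setC (reweight mu mA s) (measurableC mK).
  by rewrite setCK h sube0.
have := hmin _ rK; rewrite EV (log_energy_shift c0 mK Kc rK).
by rewrite EFinD leeBrDr.
Qed.

End equilibrium.

(** * The pointwise inequality behind Jensen's *)

Section pointwise.
Variables (R : realType) (c : R).

Lemma sum_lkern_ge (s : seq R) (x : R) : 0 < \prod_(a <- s) `|x - a| ->
  (((size s)%:R * c - ln (\prod_(a <- s) `|x - a|))%:E <=
   \sum_(a <- s) lkern c (a, x))%E.
Proof.
elim: s => [|a s ih]; first by rewrite !big_nil ln1 mul0r subrr.
rewrite !big_cons => p0.
have p1 : 0 < \prod_(a <- s) `|x - a|.
  rewrite lt_neqAle prodr_ge0// andbT eq_sym.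
  by apply/eqP => p1; move: p0; rewrite p1 mulr0 ltxx.
have p2 : 0 < `|x - a| by rewrite -(pmulr_lgt0 _ p1).
rewrite lnM ?posrE//.
have -> : (size (a :: s))%:R * c - (ln `|x - a| + ln (\prod_(j <- s) `|x - j|)) =
  (c - ln `|x - a|) + ((size s)%:R * c - ln (\prod_(j <- s) `|x - j|)).
  by rewrite /= -natr1; ring.
rewrite EFinD; apply: leeD; last exact: ih.
by apply: le_trans (lkern_ge c a x); rewrite (distrC a) lne_EFin.
Qed.

(** Some [a] equals [x] and contributes [+oo], while the other terms are nonnegative. *)
Lemma sum_lkern_eqy (s : seq R) (x : R) : \prod_(a <- s) `|x - a| = 0 ->
  (\sum_(a <- s) lkern c (a, x) = +oo)%E.
Proof.
elim: s => [|a s ih]; first by rewrite big_nil => /eqP; rewrite oner_eq0.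
have s0 y : (0 <= \sum_(a <- s) lkern c (a, y))%E.
  by apply: sume_ge0 => b _; exact: lkern_ge0.
rewrite !big_cons => /eqP; rewrite mulf_eq0 => /orP[|/eqP/ih ->].
  rewrite normr_eq0 subr_eq0 => /eqP ->; rewrite lkern_diag addye//.
  by rewrite -ltNye; apply: lt_le_trans (s0 _).
by rewrite addey// -ltNye; apply: lt_le_trans (lkern_ge0 _ _).
Qed.

(* [t >= 1 + ln t] at [t = e^(2nV) p(x)^2]: this is Jensen's inequality for
   the logarithm in a form needing no integrability of [ln |p|]. *)
Lemma jensen_pointwise (V : R) (p : {poly R}) (s : seq R) (x : R) :
  \prod_(a <- s) `|x - a| <= `|p.[x]| ->
  ((1 + 2 * (size s)%:R * (V + c))%:E <=
   (expR (2 * (size s)%:R * V) * (p * p).[x])%:E +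
   2%:E * \sum_(a <- s) lkern c (a, x))%E.
Proof.
set d := \prod_(a <- s) _ => dp.
have d0 : 0 <= d by exact: prodr_ge0.
have [dz|dn] := eqVneq d 0.
  by rewrite sum_lkern_eqy// gt0_muley ?lte_fin// addey ?leey.
have dpos : 0 < d by rewrite lt_neqAle eq_sym dn.
apply: (@le_trans _ _ ((expR (2 * (size s)%:R * V) * (p * p).[x])%:E +
   2%:E * ((size s)%:R * c - ln d)%:E)%E); last first.
  by rewrite leeD2l// lee_wpmul2l ?lee_fin// sum_lkern_ge.
rewrite -EFinM -EFinD lee_fin hornerM -expr2 -real_normK ?num_real//.
have : expR (2 * (size s)%:R * V + 2 * ln d) <=
    expR (2 * (size s)%:R * V) * `|p.[x]| ^+ 2.
  rewrite expRD ler_pM2l ?expR_gt0// expRM_natl lnK ?posrE//.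
  by rewrite lerXn2r ?nnegrE.
have := expR_ge1Dx (2 * (size s)%:R * V + 2 * ln d).
lra.
Qed.

End pointwise.

Theorem theorem1p3 (R : realType) (K : set R) (muK : borel_prob R) (n : nat) :
  compact K -> nonpolar K -> is_equilibrium_measure K muK ->
  (0 < n)%N -> 1 <= widom_factor n muK.
Proof.
move=> cK npK eqK _.
have clK : closed K by apply: compact_closed => //; exact: Rhausdorff.
have mK := compact_measurable cK.
have [V EV] := nonpolar_log_energy eqK npK.
have [c c0 Kc] := compact_dist_le_expR cK.
have [muK1 _] := eqK.
rewrite /widom_factor (capacity_equilibrium (equilibrium_measure_support eqK clK)).
rewrite EV /= (L2normE cK muK1) /=.
have [pm sp _] := orthopolyP cK muK1 n.
set p := orthopoly muK n in pm sp *.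
have [s ss hs] := monic_ge_prod_dist_real pm sp.
set L := poly_mean muK (p * p).
pose sg := expR (2 * n%:R * V).
have mh : measurable_fun [set: measurableTypeR R] (fun x => (sg * (p * p).[x])%:E).
  apply/measurable_EFinP; apply: measurable_funM => //; exact: measurable_poly.
have h0 x : (0 <= (sg * (p * p).[x])%:E)%E.
  by rewrite lee_fin mulr_ge0 ?expR_ge0// hornerM -expr2 sqr_ge0.
have k0 x : (0 <= \sum_(a <- s) lkern c (a, x))%E.
  by apply: sume_ge0 => a _; exact: lkern_ge0.
have mk : measurable_fun [set: measurableTypeR R]
    (fun x => \sum_(a <- s) lkern c (a, x))%E.
  by apply: emeasurable_fun_sum => a; exact: measurable_lkernr.
(* By symmetry of the kernel, each of the [n] terms integrates to the potential at [a], at most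
   [V + c]. *)
have intk : (\int[muK]_x \sum_(a <- s) lkern c (a, x) <= (n%:R * (V + c))%:E)%E.
  rewrite ge0_integral_sum//; last 2 first.
  - by move=> a; exact: measurable_lkernr.
  - by move=> a x _; exact: lkern_ge0.
  rewrite -ss -sum1_size natr_sum mulr_suml -sumEFin; apply: lee_sum => a _.
  by rewrite mul1r; exact: (equilibrium_potential_le mK c0 Kc eqK EV).
(* Integrating the pointwise inequality, the terms in [V + c] cancel and [1 <= e^(2nV) ||p||^2]
   remains. *)
have main : 1 <= sg * L.
  have : ((1 + 2 * n%:R * (V + c))%:E <= \int[muK]_x ((sg * (p * p).[x])%:E +
      2%:E * \sum_(a <- s) lkern c (a, x)))%E.
    apply: (@le_trans _ _ (\int[muK]_x (cst (1 + 2 * n%:R * (V + c))%:E) x)%E).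
      by rewrite integral_cst//= probability_setT mule1.
    have mF : measurable_fun [set: measurableTypeR R] (fun x =>
        (sg * (p * p).[x])%:E + 2%:E * \sum_(a <- s) lkern c (a, x))%E.
      by apply: emeasurable_funD => //; exact: measurable_funeM.
    (* Monotonicity is available for nonnegative integrands only; a negative constant is compared
       with 0 instead. *)
    have [b0|b0] := leP 0 (1 + 2 * n%:R * (V + c)).
      apply: ge0_le_integral => // x _.
      by rewrite /sg -ss; apply: jensen_pointwise.
    apply: (@le_trans _ _ 0%E).
      by rewrite integral_cst//= probability_setT mule1 lee_fin ltW.
    by apply: integral_ge0 => x _; rewrite adde_ge0// mule_ge0.
  rewrite ge0_integralD//; last 2 first.
  - by move=> x _; rewrite mule_ge0.
  - exact: measurable_funeM.
  rewrite ge0_integralZl//.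
  have -> : (\int[muK]_x (sg * (p * p).[x])%:E = (sg * L)%:E)%E.
    under eq_integral do rewrite EFinM.
    rewrite ge0_integralZl//; last 3 first.
    - by apply/measurable_EFinP; exact: measurable_poly.
    - by move=> x _; rewrite lee_fin hornerM -expr2 sqr_ge0.
    - by rewrite lee_fin expR_ge0.
    by rewrite (poly_meanE cK muK1).
  move=> h.
  have : ((1 + 2 * n%:R * (V + c))%:E <=
      (sg * L)%:E + 2%:E * (n%:R * (V + c))%:E)%E.
    by apply: le_trans h _; rewrite leeD2l// lee_wpmul2l ?lee_fin.
  by rewrite -EFinM -EFinD lee_fin; lra.
(* After squaring and multiplying by [e^(2nV)], the claim [e^(-nV) <= ||p||] becomes [main]. *)
rewrite ler_pdivlMr ?exprn_gt0 ?expR_gt0// mul1r.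
rewrite -(@ler_pXn2r _ 2) ?nnegrE ?sqrtr_ge0 ?exprn_ge0 ?expR_ge0//.
rewrite sqr_sqrtr ?poly_mean_sqr_ge0//.
rewrite -exprM -expRM_natl -(ler_pM2l (expR_gt0 (2 * n%:R * V))) -expRD.
have -> : 2 * n%:R * V + (n * 2)%:R * - V = 0 by rewrite natrM; ring.
by rewrite expR0.
Qed.
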